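(* Let $\ell\in[L]$, $k\in[n_\ell]$, $j\in[n_{\ell-1}]$, and let $\gamma=(\gamma_0,\gamma_1,\dots,\gamma_\ell)$ be any path to the $(k,j)$-th memristor in layer $\ell$. Let $\tau>0$, $T=4\tau$. Let the switches be set on $[0,T]$ to the switch settings corresponding to $\gamma$, and let the input be such that $P^0_{\gamma_0}(t)=Q(t-\tfrac T2)$ for $t\in[0,T]$. Then, for any initial conditions $\varphi^\kappa(0)=\varphi^\kappa_0\in\mathbb{R}^{n_\kappa\times n_{\kappa-1}}$, $\kappa\in[L]$, the solution of the circuit equations satisfies $\varphi^\kappa(T)=\varphi^\kappa_0$ for all $\kappa\in[L]$. Moreover, let $P_\gamma^{\ell-1}:=P^{\ell-1}_{\gamma_{\ell-1}}$ denote the resulting voltage signal, and let $\phi^\ell_{\gamma,0}:=(\varphi^\ell_0)_{\gamma_\ell,\gamma_{\ell-1}}$. Then for any $\bar\phi^\ell_{\gamma,0}\in\mathbb{R}$, $$\bar J^\ell_\gamma(t;\phi^\ell_{\gamma,0},P_\gamma^{\ell-1})=\bar J^\ell_\gamma(t;\bar\phi^\ell_{\gamma,0},P_\gamma^{\ell-1})\ \text{ for all } t\in[0,T]\quad\Longrightarrow\quad W(\phi^\ell_{\gamma,0})=W(\bar\phi^\ell_{\gamma,0}).$$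
   Context: Notation: $[n]=\{1,\dots,n\}$; $\mathbb 1_m\in\mathbb{R}^m$ is the all-ones column vector; $\odot$ is the entrywise (Hadamard) product. $L\ge 1$ and $n_0,\dots,n_L$ are positive integers. Activation function: $\sigma:\mathbb{R}\to\mathbb{R}$ is continuously differentiable, odd, strictly monotone (meaning $(\sigma(x)-\sigma(y))(x-y)>0$ for all $x\ne y$) and $\eta$-Lipschitz continuous for some $\eta>0$. $\sigma^\ell:\mathbb{R}^{n_\ell}\to\mathbb{R}^{n_\ell}$ is the entrywise application of $\sigma$. Memristors: $g:\mathbb{R}\to\mathbb{R}$ is continuously differentiable with $W(\varphi):=\frac{dg(\varphi)}{d\varphi}>0$ for all $\varphi\in\mathbb{R}$; $W$ is strictly monotone (meaning $(W(x)-W(y))(x-y)>0$ for all $x\ne y$), $\beta$-Lipschitz continuous for some $\beta>0$, and there are constants $W_{\max}\ge W_{\min}>0$ with $W_{\max}\ge W(x)\ge W_{\min}$ for all $x\in\mathbb{R}$. For a matrix $\varphi$, $W(\varphi)$ is the matrix obtained by applying $W$ entrywise. Circuit equations: with flux matrices $\varphi^\kappa(t)\in\mathbb{R}^{n_\kappa\times n_{\kappa-1}}$, switch matrices $S^\kappa(t)\in\{0,1\}^{n_\kappa\times n_{\kappa-1}}$ and input $P^0(t)\in\mathbb{R}^{n_0}$, $$\tfrac{d}{dt}\varphi^\kappa=S^\kappa\odot(\mathbb 1_{n_\kappa}(P^{\kappa-1})^\top),\quad \bar J^\kappa=(W(\varphi^\kappa)\odot S^\kappa)P^{\kappa-1},\quad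 P^\kappa=\sigma^\kappa(\bar J^\kappa)\qquad(\kappa\in[L]).$$ The differential equations are understood in integrated form since signals may be discontinuous; the relations for $\bar J^\kappa,P^\kappa$ hold pointwise in $t$. Path: a path to the $(k,j)$-th memristor in layer $\ell$ is a tuple $\gamma=(\gamma_0,\gamma_1,\dots,\gamma_\ell)$ with $\gamma_\kappa\in[n_\kappa]$ for all $\kappa$, $\gamma_{\ell-1}=j$ and $\gamma_\ell=k$. Switch settings corresponding to $\gamma$: for $\kappa\in[\ell]$, $S^\kappa_{ab}=1$ if $a=\gamma_\kappa$ and $b=\gamma_{\kappa-1}$, and $S^\kappa_{ab}=0$ otherwise; if $\ell<L$, $S^{\ell+1}=0$, and $S^\kappa$ is arbitrary for $\kappa\in\{\ell+2,\dots,L\}$. (The components $P^0_b$ with $b\neq\gamma_0$ are not prescribed; all switches in the corresponding columns of layer 1 are open.) Current notation: for $\phi_0\in\mathbb{R}$ and a scalar voltage signal $p$ on $[0,T]$, $\bar J^\ell_\gamma(t;\phi_0,p):=W(\phi(t))\,p(t)$, where $\phi(t)=\phi_0+\int_0^t p(s)\,ds$; this is the current $\bar J^\ell_{\gamma_\ell}$ at the end of row $\gamma_\ell$ of layer $\ell$ when the $(\gamma_\ell,\gamma_{\ell-1})$ memristor of layer $\ell$ has initial flux $\phi_0$ and receives voltage $p$. Block signal: for $\tau>0$, $Q(t)=0$ for $t<-2\tau$; $Q(t)=-1$ for $t\in[-2\tau,-\tau)$; $Q(t)=1$ for $t\in[-\tau,\tau]$; $Q(t)=-1$ for $t\in(\tau,2\tau]$;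 $Q(t)=0$ for $t>2\tau$. *)

(* Defs.v *)
(* MathComp / MathComp-Analysis *)
From mathcomp Require Export all_boot all_order all_algebra.
From mathcomp Require Export all_classical all_reals all_analysis.
Export Order.TTheory GRing.Theory Num.Theory.
Export numFieldNormedType.Exports.

Set Implicit Arguments.
Unset Strict Implicit.
Unset Printing Implicit Defensive.

Local Open Scope classical_set_scope.
Local Open Scope ring_scope.

Definition C1 (R : realType) (f : R -> R) : Prop :=
  (forall x, derivable f x 1) /\ continuous (derive1 f).

Definition strictly_monotone (R : realType) (f : R -> R) : Prop :=
  forall x y, x != y -> 0 < (f x - f y) * (x - y).

Definition is_Lipschitz (R : realType) (f : R -> R) : Prop :=
  exists2 k : R, 0 < k & k.-lipschitz f.

Definition activation (R : realType) (sigma : R -> R) : Prop :=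
  [/\ C1 sigma, forall x, sigma (- x) = - sigma x,
      strictly_monotone sigma & is_Lipschitz sigma].

Definition memristor (R : realType) (g : R -> R) : Prop :=
  let W := derive1 g in
  [/\ C1 g, forall x, 0 < W x, strictly_monotone W, is_Lipschitz W &
      exists Wmin Wmax : R,
        [/\ 0 < Wmin, Wmin <= Wmax & forall x, Wmin <= W x <= Wmax]].

Definition hadamard (R : realType) (m n : nat) (A B : 'M[R]_(m, n)) :
  'M[R]_(m, n) := map2_mx *%R A B.

(* A switch matrix is boolean; it enters the equations through its 0/1 matrix. *)
Definition mx01 (R : realType) (m n : nat) (S : 'M[bool]_(m, n)) :
  'M[R]_(m, n) := map_mx (fun b : bool => b%:R) S.

(* The layer widths n_0, ..., n_L are the first values of a sequence
   n : nat -> nat.  Layer k (1 <= k <= L) carries matrices of type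
   'M_(n k, n k.-1); the components of index 0 or > L of a family of matrices
   are unconstrained and irrelevant. *)

(* Right-hand side of the flux equation of layer k, as a function of time. *)
Definition flux_rate (R : realType) (n : nat -> nat)
    (S : forall k, R -> 'M[bool]_(n k, n k.-1))
    (P : forall k, R -> 'cV[R]_(n k)) (k : nat) (t : R) :
    'M[R]_(n k, n k.-1) :=
  hadamard (mx01 R (S k t)) ((const_mx 1 : 'cV_(n k)) *m (P k.-1 t)^T).

(* The integrability clause makes the (total) integral meaningful. *)
Definition circuit_solution (R : realType) (L : nat) (n : nat -> nat)
    (sigma g : R -> R) (T : R)
    (S : forall k, R -> 'M[bool]_(n k, n k.-1)) (P0 : R -> 'cV[R]_(n 0%N))
    (phi0 : forall k, 'M[R]_(n k, n k.-1))
    (phi : forall k, R -> 'M[R]_(n k, n k.-1))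
    (J P : forall k, R -> 'cV[R]_(n k)) : Prop :=
  (forall t : R, t \in `[0, T] -> P 0%N t = P0 t) /\
  (forall k, (1 <= k <= L)%N ->
    [/\ forall a b, lebesgue_measure.-integrable `[0, T]
          (fun s => (flux_rate S P k s a b)%:E),
        forall t : R, t \in `[0, T] -> forall a b,
          phi k t a b = phi0 k a b +
            \int[lebesgue_measure]_(s in `[0, t]) flux_rate S P k s a b,
        forall t : R, t \in `[0, T] ->
          J k t = hadamard (map_mx (derive1 g) (phi k t)) (mx01 R (S k t))
                    *m P k.-1 t
      & forall t : R, t \in `[0, T] -> P k t = map_mx sigma (J k t)]).

(* Only the entries gamma_0, ..., gamma_l of gamma matter; since every n k is
   positive, a tuple (gamma_0, ..., gamma_l) always extends to such a gamma. *)
Definition path_to (n : nat -> nat) (gamma : forall k, 'I_(n k)) (l : nat)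
    (k : 'I_(n l)) (j : 'I_(n l.-1)) : Prop :=
  gamma l.-1 = j /\ gamma l = k.

Definition switch_setting (L : nat) (n : nat -> nat)
    (gamma : forall k, 'I_(n k)) (l : nat)
    (S : forall k, 'M[bool]_(n k, n k.-1)) : Prop :=
  (forall k, (1 <= k <= l)%N ->
     forall a b, S k a b = (a == gamma k) && (b == gamma k.-1)) /\
  ((l < L)%N -> forall a b, S l.+1 a b = false).

Definition memristor_current (R : realType) (g : R -> R) (t phi0 : R)
    (p : R -> R) : R :=
  derive1 g (phi0 + \int[lebesgue_measure]_(s in `[0, t]) p s) * p t.

Definition block_signal (R : realType) (tau t : R) : R :=
  if t < - (2 * tau) then 0
  else if t < - tau then -1
  else if t <= tau then 1
  else if t <= 2 * tau then -1
  else 0.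

(* Main.v *)
From mathcomp Require Import measurable_realfun zify ring lra.
Require Import Defs.

(** Along the path, every signal of the circuit is a function of one scalar:
    the flux x(t) = int_0^t q of the block signal q that drives the path
    ([block_flux] and [block_drive] below).  Because q takes the values 1 and
    -1 only and sigma is odd, a sign can be pulled out of sigma.  Hence, if the
    voltage entering a layer is q(t) h(x(t)) with h continuous, then, x' being
    q, the flux of the memristor on the path moves by H(x(t)), where H is the
    primitive of h with H(0) = 0 ([block_increment]), and the voltage leaving
    the layer is
      sigma (W (phi0 + H(x)) q h(x)) = q sigma (W (phi0 + H(x)) h(x)),
    which has the same form.  The resulting functions h are the [gain]s, and
    [follows_path] is the invariant carried from layer to layer
    ([follows_pathS]).

    The block signal has mean zero, so x(T) = 0 and all fluxes on the path
    return to their initial values.  The other fluxes do not move: in the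
    layers up to l their switches are open, and the open switches of layer
    l + 1 turn off all later voltages, since sigma 0 = 0.

    Solving the equations layer by layer yields a solution
    ([forward_solution]); the only thing to check is the integrability of the
    flux rates, which again follows from the form q(t) h(x(t)).

    The two currents in the last claim need only be compared at t = 0.  There
    both fluxes have their initial values, and the voltage is nonzero because
    W > 0 and sigma vanishes at 0 only ([path_voltage_neq0]). *)

Set Implicit Arguments.
Unset Strict Implicit.
Unset Printing Implicit Defensive.

Local Open Scope classical_set_scope.
Local Open Scope ring_scope.

(** * Primitives of continuous functions and piecewise antiderivatives *)

Section Primitive.
Context {R : realType}.
Notation mu := (@lebesgue_measure R).
Implicit Types (f p h : R -> R).

Lemma continuous_integrable_itv (a b : R) f :
  continuous f -> mu.-integrable `[a, b] (EFin \o f).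
Proof.
move=> cf; apply: continuous_compact_integrable; first exact: segment_compact.
exact: continuous_subspaceT.
Qed.

(** The primitive of f that vanishes at 0, on both sides of 0.  Writing it as a
    difference of two integrals that start left of 0 and of x avoids
    oriented integrals; the start -(|x| + 1) is immaterial by [primitiveE]. *)
Definition primitive f (x : R) : R :=
  \int[mu]_(t in `[- (`|x| + 1), x]) f t -
  \int[mu]_(t in `[- (`|x| + 1), 0]) f t.

Lemma primitive0 f : primitive f 0 = 0.
Proof. exact: subrr. Qed.

(** One starting point a serves all points near a given x, which is the form in
    which the fundamental theorem of calculus applies. *)
Lemma primitiveE f (a x : R) : continuous f -> a <= - (`|x| + 1) ->
  primitive f x = \int[mu]_(t in `[a, x]) f t - \int[mu]_(t in `[a, 0]) f t.
Proof.
move=> cf ax; rewrite /primitive; set b := - _.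
have xb : b <= x by rewrite /b; have := ler_norm (- x); rewrite normrN; lra.
have b0 : b <= 0 by rewrite /b; have := normr_ge0 x; lra.
have shift (y : R) : b <= y ->
    \int[mu]_(t in `[a, y]) f t =
    \int[mu]_(t in `[a, b]) f t + \int[mu]_(t in `[b, y]) f t.
  move=> yb; apply/eqP; rewrite addrC -subr_eq; apply/eqP.
  rewrite Rintegral_itvB ?bnd_simp//; last exact: continuous_integrable_itv.
  rewrite Rintegral_itv_obnd_cbnd//.
  apply: (@integrableS _ _ _ mu `[b, y]) => //;
    last exact: continuous_integrable_itv.
  by apply: subset_itvr; rewrite bnd_simp.
by rewrite (shift x)// (shift 0)//; ring.
Qed.

Lemma is_derive_primitive f (x : R) : continuous f ->
  is_derive x 1 (primitive f) (f x).
Proof.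
move=> cf; pose a := - (`|x| + 2).
have near_eq : \near x, \int[mu]_(t in `[a, x]) f t -
    \int[mu]_(t in `[a, 0]) f t = primitive f x.
  near=> y; rewrite (@primitiveE f a y)//.
  have : `|x - y| < 1 by near: y; exact: cvgr_dist_lt.
  rewrite /a => xy1; have := ler_distD x y 0.
  by rewrite !subr0 distrC; lra.
apply: near_eq_is_derive near_eq _.
have ax : a < x by rewrite /a; have := ler_norm (- x); rewrite normrN; lra.
have xx1 : x < x + 1 by rewrite ltrDl.
have [dF F'] := continuous_FTC1_closed xx1
  (continuous_integrable_itv a (x + 1) cf) ax (cf x).
have : is_derive x 1 (fun x => \int[mu]_(t in `[a, x]) f t) (f x).
  by split=> //; rewrite -F' derive1E.
move=> ?; apply: is_derive_eq; by rewrite subr0.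
Unshelve. all: by end_near. Qed.

Lemma continuous_primitive f : continuous f -> continuous (primitive f).
Proof.
move=> cf x; apply: differentiable_continuous; apply/derivable1_diffP.
by have [] := is_derive_primitive x cf.
Qed.

(** Integrability is part of the notion, so that increments can be
    concatenated; see [has_increment_cat]. *)
Definition has_increment p (Z : R -> R) (u v : R) :=
  mu.-integrable `[u, v] (EFin \o p) /\
  \int[mu]_(t in `[u, v]) p t = Z v - Z u.

Lemma has_increment_cat p Z (u v w : R) : u <= v -> v <= w ->
  has_increment p Z u v -> has_increment p Z v w -> has_increment p Z u w.
Proof.
move=> uv vw [pi1 e1] [pi2 e2].
have pi2' : mu.-integrable `]v, w] (EFin \o p).
  apply: integrableS pi2 => //.
  by apply: subset_itvr; rewrite bnd_simp.
have split_uw : `[u, w]%classic = `[u, v]%classic `|` `]v, w]%classic.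
  by apply: itv_bndbnd_setU; rewrite bnd_simp.
have disj : [disjoint `[u, v]%classic & `]v, w]%classic].
  apply/disj_setPS => y [/=]; rewrite !in_itv/= => /andP[_ yv] /andP[].
  by rewrite ltNge yv.
have pi : mu.-integrable `[u, w] (EFin \o p).
  have /integrableP[m1 i1] := pi1; have /integrableP[m2 i2] := pi2'.
  have m12 : measurable_fun `[u, w] p.
    by rewrite split_uw; apply/measurable_funU => //; split;
      exact/measurable_EFinP.
  apply/integrableP; split; first exact/measurable_EFinP.
  rewrite split_uw.
  rewrite ge0_integral_setU//; first exact: lte_add_pinfty.
  rewrite -split_uw; apply: measurableT_comp => //; exact/measurable_EFinP.
split=> //.
rewrite split_uw Rintegral_setU// -?split_uw// e1.
by rewrite Rintegral_itv_obnd_cbnd// e2; ring.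
Qed.

(** The substitution rule for h along the affine path c + s t.  The formula for
    p is required in the open interval only: the block signal takes the value
    of one of its neighbouring pieces at each jump. *)
Lemma has_increment_affine h p Z (s c u v : R) : u <= v -> continuous h ->
  (forall t, u < t < v -> p t = s * h (c + s * t)) ->
  (forall t, u <= t <= v -> Z t = primitive h (c + s * t)) ->
  has_increment p Z u v.
Proof.
move=> uv ch pE ZE.
pose q t := s * h (c + s * t).
pose F t := primitive h (c + s * t).
have dF (t : R) : is_derive t 1 F (q t).
  have dl : is_derive t 1 (fun t : R => c + s * t) s.
    by apply: is_derive_eq; rewrite add0r mul1r; exact: mulr1.
  have dh := is_derive_primitive (c + s * t) ch.
  have := @is_derive1_comp _ (primitive h) (fun t => c + s * t) t _ _ dh dl.
  by rewrite /q mulrC.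
have cq : continuous q.
  move=> t; apply: cvgM; first exact: cvg_cst.
  apply: (@continuous_comp _ _ _ (fun t => c + s * t) h); last exact: ch.
  by apply: cvgD; [exact: cvg_cst|apply: cvgM; [exact: cvg_cst|exact: cvg_id]].
have cF : continuous F.
  move=> t; apply: differentiable_continuous; apply/derivable1_diffP.
  by have [] := dF t.
have qi := continuous_integrable_itv u v cq.
have pq : {in `]u, v[, p =1 q} by move=> t; rewrite in_itv/=; exact: pE.
have mq : measurable_fun `[u, v] q.
  by apply/measurable_EFinP; exact: measurable_int qi.
have mq' : measurable_fun `]u, v[ q.
  by apply: measurable_funS mq => //; exact: subset_itv_oo_cc.
have mp' : measurable_fun `]u, v[ p.
  apply: eq_measurable_fun mq' => t; rewrite inE/= => tuv.
  by rewrite pq.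
have mp : measurable_fun `[u, v] p by exact: measurable_fun_itv_cc mp'.
split.
  apply/integrableP; split; first exact/measurable_EFinP.
  have /integrableP[_] := qi; apply: le_lt_trans.
  rewrite (@eq_integral_itv_bounded _ _ _
    (fun t => `|q t|) (fun t => `|p t|))//.
  - exact: measurableT_comp.
  - exact: measurableT_comp.
  - by move=> t tuv /=; rewrite pq.
rewrite /Rintegral (@eq_integral_itv_bounded _ _ _ q p)//.
rewrite !ZE ?lexx ?uv//.
move: uv; rewrite le_eqVlt => /predU1P[<-|uv].
  by rewrite subrr set_itv1 integral_set1.
rewrite (continuous_FTC2 uv (F := F))//.
- exact: continuous_subspaceT.
- split=> [t _||]; first by have [] := dF t.
  + exact/cvg_at_right_filter/cF.
  + exact/cvg_at_left_filter/cF.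
- by move=> t _; rewrite derive1E; have [_] := dF t.
Qed.

End Primitive.

(** * The block signal and its flux *)

Section Block.
Context {R : realType}.
Notation mu := (@lebesgue_measure R).
Implicit Types (tau t : R).

Definition block_drive tau t := block_signal tau (t - 2 * tau).

Definition block_flux tau t :=
  if t <= tau then - t else if t <= 3 * tau then t - 2 * tau else 4 * tau - t.

Lemma block_driveE tau t : 0 < tau -> 0 <= t <= 4 * tau ->
  block_drive tau t = if (tau <= t) && (t <= 3 * tau) then 1 else -1.
Proof.
move=> tau0 /andP[t0 t4]; rewrite /block_drive /block_signal.
rewrite ifF; last by apply/negbTE; rewrite -leNgt; lra.
rewrite (_ : (t - 2 * tau < - tau) = (t < tau)); last by apply/idP/idP; lra.
rewrite (_ : (t - 2 * tau <= tau) = (t <= 3 * tau)); last by apply/idP/idP; lra.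
rewrite ltNge; case: (leP tau t) => //= taut; case: ifP => // _.
by rewrite ifT//; lra.
Qed.

Lemma block_flux0 tau : 0 < tau -> block_flux tau 0 = 0.
Proof. by move=> tau0; rewrite /block_flux ltW// oppr0. Qed.

Lemma block_fluxT tau : 0 < tau -> block_flux tau (4 * tau) = 0.
Proof.
move=> tau0; rewrite /block_flux ifF; last by apply/negbTE; rewrite -ltNge; lra.
by rewrite ifF ?subrr//; apply/negbTE; rewrite -ltNge; lra.
Qed.

(** The fluxes reached are functions of x(t): the integral of q h(x) is H(x),
    checked on the three pieces where the flux x is affine. *)
Lemma block_increment (h : R -> R) tau t :
    0 < tau -> continuous h -> 0 <= t <= 4 * tau ->
  has_increment (fun s => block_drive tau s * h (block_flux tau s))
    (primitive h \o block_flux tau) 0 t.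
Proof.
move=> tau0 ch /andP[t0 t4]; set p := fun s => _; set Z := _ \o _.
have down1 u : 0 <= u <= tau -> has_increment p Z 0 u.
  move=> /andP[u0 ut]; apply: (@has_increment_affine _ h p Z (-1) 0) => // s.
    move=> /andP[s0 su].
    rewrite /p block_driveE//; last by apply/andP; split; lra.
    by rewrite ifF ?/block_flux ?ifT ?add0r ?mulN1r//; [lra|apply/negbTE; lra].
  move=> /andP[s0 su]; rewrite /Z/= /block_flux ifT ?add0r ?mulN1r//; lra.
have up u : tau <= u <= 3 * tau -> has_increment p Z tau u.
  move=> /andP[u0 ut].
  apply: (@has_increment_affine _ h p Z 1 (- (2 * tau))) => // s.
    move=> /andP[s0 su].
    rewrite /p block_driveE//; last by apply/andP; split; lra.
    rewrite ifT; last by apply/andP; split; lra.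
    rewrite /block_flux ifF; last by apply/negbTE; rewrite -ltNge; lra.
    by rewrite ifT ?mul1r 1?addrC//; lra.
  move=> /andP[s0 su]; rewrite /Z/= /block_flux; case: ifPn => s1.
    by congr primitive; lra.
  by rewrite ifT ?mul1r 1?addrC//; lra.
have down2 u : 3 * tau <= u <= 4 * tau -> has_increment p Z (3 * tau) u.
  move=> /andP[u0 ut].
  apply: (@has_increment_affine _ h p Z (-1) (4 * tau)) => // s.
    move=> /andP[s0 su].
    rewrite /p block_driveE//; last by apply/andP; split; lra.
    rewrite ifF; last by apply/negbTE; rewrite negb_and -!ltNge s0 orbT.
    rewrite /block_flux ifF; last by apply/negbTE; rewrite -ltNge; lra.
    rewrite ifF; last by apply/negbTE; rewrite -ltNge; lra.
    by rewrite !mulN1r.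
  move=> /andP[s0 su]; rewrite /Z/= /block_flux ifF; last first.
    by apply/negbTE; rewrite -ltNge; lra.
  case: ifPn => s1; last by rewrite mulN1r.
  by congr primitive; lra.
have [t1|t1] := leP t tau; first by apply: down1; rewrite t0.
apply: (@has_increment_cat _ _ _ _ tau); [lra|lra|by apply: down1; lra|].
have [t3|t3] := leP t (3 * tau); first by apply: up; lra.
apply: (@has_increment_cat _ _ _ _ (3 * tau)); [lra|lra|by apply: up; lra|].
by apply: down2; lra.
Qed.

End Block.

(** * The gain of a chain of memristors *)

Section Gain.
Context {R : realType}.
Notation mu := (@lebesgue_measure R).

(** With x the flux of the block signal, [gain m x] is the factor by which m
    layers multiply the block signal; c lists the initial fluxes of the
    memristors on the path. *)
Fixpoint gain (sigma W : R -> R) (c : nat -> R) (m : nat) : R -> R :=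
  if m is m'.+1 then
    fun y => sigma (W (c m' + primitive (gain sigma W c m') y) *
                    gain sigma W c m' y)
  else fun=> 1.

Lemma continuous_gain (sigma W : R -> R) (c : nat -> R) m :
  continuous sigma -> continuous W -> continuous (gain sigma W c m).
Proof.
move=> cs cW; elim: m => [|m IH] y /=; first exact: cvg_cst.
apply: (@continuous_comp _ _ _
  (fun y => W (c m + primitive (gain sigma W c m) y) * gain sigma W c m y) sigma);
  last exact: cs.
apply: cvgM; last exact: IH.
apply: (@continuous_comp _ _ _
  (fun y => c m + primitive (gain sigma W c m) y) W);
  last exact: cW.
by apply: cvgD; [exact: cvg_cst|exact: continuous_primitive].
Qed.

Lemma C1_continuous (f : R -> R) : C1 f -> continuous f.
Proof.
by move=> [df _] x; apply: differentiable_continuous; apply/derivable1_diffP.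
Qed.

Lemma memristor_continuous (g : R -> R) : memristor g -> continuous (derive1 g).
Proof. by case=> -[]. Qed.

Lemma activation0 (sigma : R -> R) : activation sigma -> sigma 0 = 0.
Proof. by case=> _ odd _ _; have := odd 0; rewrite oppr0; lra. Qed.

Lemma activation_eq0 (sigma : R -> R) y : activation sigma ->
  (sigma y == 0) = (y == 0).
Proof.
move=> asig; have s0 := activation0 asig; case: asig => _ _ mono _.
have [->|y0] := eqVneq y 0; first by rewrite s0 eqxx.
apply/negbTE/negP => /eqP sy; have := mono _ _ y0.
by rewrite sy s0 subrr mul0r ltxx.
Qed.

(** A positive memductance and an odd, strictly monotone activation never map a
    nonzero voltage to zero. *)
Lemma gain_neq0 (sigma W : R -> R) (c : nat -> R) m y :
  activation sigma -> (forall x, 0 < W x) -> gain sigma W c m y != 0.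
Proof.
move=> asig W0; elim: m => [|m IH] /=; first exact: oner_neq0.
by rewrite activation_eq0// mulf_neq0// gt_eqF.
Qed.

(** The block signal is 1 or -1, so its sign passes through the odd sigma. *)
Lemma activation_sign (sigma : R -> R) (tau t z : R) :
    activation sigma -> 0 < tau -> 0 <= t <= 4 * tau ->
  sigma (block_drive tau t * z) = block_drive tau t * sigma z.
Proof.
case=> _ odd _ _ tau0 tT; rewrite block_driveE//.
by case: ifP => _; rewrite ?mul1r// !mulN1r odd.
Qed.

End Gain.

(** * Solutions of the circuit equations *)

Section Circuit.
Context {R : realType}.
Notation mu := (@lebesgue_measure R).
Variables (L : nat) (n : nat -> nat) (sigma g : R -> R).
Hypotheses (asig : activation sigma) (memg : memristor g).
Variables (l : nat) (gamma : forall k, 'I_(n k)) (tau : R).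
Hypotheses (lL : (l <= L)%N) (tau0 : 0 < tau).
Variables (S : forall k, R -> 'M[bool]_(n k, n k.-1)).
Hypothesis setS : forall t : R, t \in `[0, 4 * tau] ->
  switch_setting L gamma l (fun k => S k t).
Variable P0 : R -> 'cV[R]_(n 0%N).
Hypothesis P0E : forall t : R, t \in `[0, 4 * tau] ->
  P0 t (gamma 0%N) 0 = block_drive tau t.
Variable phi0 : forall k, 'M[R]_(n k, n k.-1).
Implicit Types (phi : forall k, R -> 'M[R]_(n k, n k.-1))
  (J P : forall k, R -> 'cV[R]_(n k)).

Let path_flux0 m : R := phi0 m.+1 (gamma m.+1) (gamma m).
Let path_gain := gain sigma (derive1 g) path_flux0.

Let continuous_path_gain m : continuous (path_gain m).
Proof.
apply: continuous_gain; last exact: memristor_continuous.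
by case: asig => /C1_continuous.
Qed.

Definition path_voltage m (t : R) : R :=
  block_drive tau t * path_gain m (block_flux tau t).

Lemma flux_rateE P k t a b :
  flux_rate S P k t a b = (S k t a b)%:R * P k.-1 t b 0.
Proof. by rewrite /flux_rate !mxE big_ord1 !mxE mul1r. Qed.

Lemma currentE P phi k t a :
  (hadamard (map_mx (derive1 g) (phi k t)) (mx01 R (S k t)) *m P k.-1 t) a 0
  = \sum_b derive1 g (phi k t a b) * (S k t a b)%:R * P k.-1 t b 0.
Proof. by rewrite mxE; apply: eq_bigr => b _; rewrite !mxE. Qed.

Definition path_entry k (a : 'I_(n k)) (b : 'I_(n k.-1)) : bool :=
  [&& (0 < k <= l)%N, a == gamma k & b == gamma k.-1].

(** In the layers up to l, only the voltage on the path is known: the other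
    entries of the input are arbitrary, and open switches make them
    harmless. *)
Definition follows_path P k := forall t, t \in `[0, 4 * tau] ->
  ((k <= l)%N -> P k t (gamma k) 0 = path_voltage k t) /\
  ((l < k)%N -> P k t = 0).

(** A flux changes on the path only: elsewhere the switch is open, or, beyond
    layer l + 1 where switches are arbitrary, the voltage is zero. *)
Lemma path_flux_rate P k t a b : (0 < k <= L)%N -> follows_path P k.-1 ->
    t \in `[0, 4 * tau] ->
  flux_rate S P k t a b = (path_entry a b)%:R * path_voltage k.-1 t.
Proof.
move=> /andP[k0 kL] PE tT; rewrite flux_rateE /path_entry.
have [Spath Sopen] := setS tT; have [Ppath Poff] := PE t tT.
have [kl|lk] := leqP k l.
  rewrite k0 /= Spath ?k0//.
  have [_|_] := eqVneq a (gamma k); last by rewrite !mul0r.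
  have [->|_] := eqVneq b (gamma k.-1); last by rewrite !mul0r.
  by rewrite Ppath// (leq_trans (leq_pred _)).
rewrite andbF mul0r.
have [kE|kl1] := eqVneq k l.+1.
  by move: a b; rewrite kE => a b; rewrite Sopen ?mul0r// -kE.
rewrite Poff; first by rewrite mxE mulr0.
by case: k k0 kL lk kl1 {a b PE Ppath Poff} => //= k _ kL lk kl1; lia.
Qed.

Lemma path_flux P k a b : (0 < k <= L)%N -> follows_path P k.-1 ->
  mu.-integrable `[0, 4 * tau] (fun s => (flux_rate S P k s a b)%:E) /\
  forall t, t \in `[0, 4 * tau] ->
    \int[mu]_(s in `[0, t]) flux_rate S P k s a b =
    (path_entry a b)%:R * primitive (path_gain k.-1) (block_flux tau t).
Proof.
move=> kL PE.
have incr t : t \in `[0, 4 * tau] ->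
    has_increment (path_voltage k.-1)
      (primitive (path_gain k.-1) \o block_flux tau) 0 t.
  by rewrite in_itv/= => t4; apply: block_increment.
have T4 : 4 * tau \in `[0, 4 * tau].
  by rewrite in_itv/= lexx andbT mulr_ge0// ltW.
split.
  have [+ _] := incr _ T4 => it.
  have := @integrableZl _ _ _ mu _ (measurable_itv _) (path_entry a b)%:R _ it.
  apply: eq_integrable => // t.
  by rewrite inE/= => tT; rewrite path_flux_rate// EFinM.
move=> t tT; have [it e] := incr _ tT.
transitivity (\int[mu]_(s in `[0, t])
    ((path_entry a b)%:R * path_voltage k.-1 s)).
  apply: eq_Rintegral => s; rewrite inE/= in_itv/= => /andP[s0 st].
  rewrite path_flux_rate// in_itv/= s0 (le_trans st)//.
  by move: tT; rewrite in_itv => /andP[].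
by rewrite RintegralZl// e /= block_flux0// primitive0 subr0.
Qed.

Lemma follows_path0 P : (0 < l)%N ->
  (forall t, t \in `[0, 4 * tau] -> P 0%N t = P0 t) -> follows_path P 0.
Proof.
by move=> l0 PP0 t tT; split=> // _; rewrite PP0// P0E// /path_voltage mulr1.
Qed.

(** The induction step along the layers.  It only assumes the equations of the
    layer m + 1, so that it applies both to a given solution and, before the
    integrability of the flux rates is known, to the solution under
    construction. *)
Lemma follows_pathS P phi m : (m < L)%N -> follows_path P m ->
    (forall t, t \in `[0, 4 * tau] -> forall a b, phi m.+1 t a b =
       phi0 m.+1 a b + \int[mu]_(s in `[0, t]) flux_rate S P m.+1 s a b) ->
    (forall t, t \in `[0, 4 * tau] -> P m.+1 t = map_mx sigma
       (hadamard (map_mx (derive1 g) (phi m.+1 t)) (mx01 R (S m.+1 t))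
          *m P m t)) ->
  follows_path P m.+1.
Proof.
move=> mL PE phiE PS t tT; rewrite PS//.
have [Spath Sopen] := setS tT; have [Ppath Poff] := PE t tT.
split=> [ml|lm].
  rewrite mxE (@currentE P phi m.+1) /= (bigD1 (gamma m))//= big1; last first.
    by move=> b bm; rewrite Spath ?ml// (negbTE bm) andbF mulr0 mul0r.
  (* the sum over the row has a single closed switch *)
  rewrite addr0 Spath ?ml//= !eqxx mulr1 Ppath 1?ltnW// phiE//.
  have [_ fluxE] := @path_flux P m.+1 (gamma m.+1) (gamma m) mL PE.
  rewrite fluxE//.
  rewrite /path_entry ml /= !eqxx mul1r mulrC /path_voltage -mulrA.
  by rewrite activation_sign// [X in sigma X]mulrC.
apply/matrixP => a i; rewrite ord1 mxE (@currentE P phi m.+1) big1 ?mxE.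
  exact: activation0.
move=> b _; have [mE|ml] := eqVneq m l.
  by move: a b; rewrite mE => a b; rewrite Sopen ?mulr0 ?mul0r// -mE.
by rewrite /= Poff ?mxE ?mulr0//; lia.
Qed.

Lemma solution_follows_path phi J P k : (0 < l)%N ->
    circuit_solution L sigma g (4 * tau) S P0 phi0 phi J P ->
  (k <= L)%N -> follows_path P k.
Proof.
move=> l0 [P0eq sol]; elim: k => [_|k IH kL]; first exact: follows_path0.
have [_ phiE JE PE] := sol k.+1 kL.
apply: follows_pathS phiE _ => //; first exact: IH (ltnW kL).
by move=> t tT; rewrite PE// JE.
Qed.

(** The layer equations solved one after the other.  The integrand is
    [flux_rate] unfolded, because [flux_rate] takes the voltages of all layers
    and the recursion has only those of the previous one. *)
Fixpoint forward_voltage k : R -> 'cV[R]_(n k) :=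
  if k is m.+1 then fun t => map_mx sigma
    (hadamard (map_mx (derive1 g) (\matrix_(a, b) (phi0 m.+1 a b +
         \int[mu]_(s in `[0, t]) (hadamard (mx01 R (S m.+1 s))
           ((const_mx 1 : 'cV_(n m.+1)) *m (forward_voltage m s)^T)) a b)))
       (mx01 R (S m.+1 t)) *m forward_voltage m t)
  else P0.

Definition forward_flux k (t : R) : 'M[R]_(n k, n k.-1) :=
  \matrix_(a, b) (phi0 k a b +
    \int[mu]_(s in `[0, t]) flux_rate S forward_voltage k s a b).

Definition forward_current k (t : R) : 'cV[R]_(n k) :=
  hadamard (map_mx (derive1 g) (forward_flux k t)) (mx01 R (S k t))
    *m forward_voltage k.-1 t.

Lemma forward_solution : (0 < l)%N ->
  circuit_solution L sigma g (4 * tau) S P0 phi0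
    forward_flux forward_current forward_voltage.
Proof.
move=> l0; have fluxE k t a b : forward_flux k t a b = phi0 k a b +
    \int[mu]_(s in `[0, t]) flux_rate S forward_voltage k s a b.
  by rewrite mxE.
have path k : (k <= L)%N -> follows_path forward_voltage k.
  elim: k => [_|k IH kL]; first exact: follows_path0.
  by apply: (follows_pathS kL (IH (ltnW kL)) (phi := forward_flux)).
split=> // -[//|k] kL; split=> // a b.
by have [] := path_flux a b (k := k.+1) kL (path k (ltnW kL)).
Qed.

Lemma solution_returns phi J P k : (0 < l)%N ->
    circuit_solution L sigma g (4 * tau) S P0 phi0 phi J P ->
  (0 < k <= L)%N -> phi k (4 * tau) = phi0 k.
Proof.
move=> l0 sol kL; have [_ phiE _ _] := sol.2 k kL.
have T4 : 4 * tau \in `[0, 4 * tau].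
  by rewrite in_itv/= lexx andbT mulr_ge0// ltW.
have PE : follows_path P k.-1.
  apply: solution_follows_path sol _ => //.
  by rewrite (leq_trans (leq_pred _))//; case/andP: kL.
apply/matrixP => a b; rewrite phiE//; have [_ ->//] := path_flux a b kL PE.
by rewrite block_fluxT// primitive0 mulr0 addr0.
Qed.

(** At t = 0 the block signal starts with -1. *)
Lemma path_voltage_neq0 m : path_voltage m 0 != 0.
Proof.
have T0 : 0 <= (0 : R) <= 4 * tau by rewrite lexx mulr_ge0// ltW.
rewrite mulf_neq0//; first by rewrite block_driveE//; case: ifP => _;
  rewrite ?oppr_eq0 oner_eq0.
by apply: gain_neq0 => //; case: memg.
Qed.

End Circuit.

Theorem theorem2 (R : realType) (L : nat) (hL : (1 <= L)%N)
    (n : nat -> nat) (n_gt0 : forall kappa, (0 < n kappa)%N)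
    (sigma : R -> R) (hsigma : activation sigma)
    (g : R -> R) (hg : memristor g)
    (l : nat) (hl : (1 <= l <= L)%N) (k : 'I_(n l)) (j : 'I_(n l.-1))
    (gamma : forall kappa, 'I_(n kappa)) (hgamma : path_to gamma k j)
    (tau : R) (htau : 0 < tau) (T : R) (hT : T = 4 * tau)
    (S : forall kappa, R -> 'M[bool]_(n kappa, n kappa.-1))
    (hS : forall t : R, t \in `[0, T] ->
       switch_setting L gamma l (fun kappa => S kappa t))
    (P0 : R -> 'cV[R]_(n 0%N))
    (hP0 : forall t : R, t \in `[0, T] ->
       P0 t (gamma 0%N) 0 = block_signal tau (t - T / 2))
    (phi0 : forall kappa, 'M[R]_(n kappa, n kappa.-1)) :
  (exists phi J P, circuit_solution L sigma g T S P0 phi0 phi J P) /\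
  (forall phi J P, circuit_solution L sigma g T S P0 phi0 phi J P ->
    (forall kappa, (1 <= kappa <= L)%N -> phi kappa T = phi0 kappa) /\
    (let Pgamma := fun t => P l.-1 t (gamma l.-1) 0 in
     let phi_gamma0 := phi0 l (gamma l) (gamma l.-1) in
     forall phi_bar : R,
       (forall t : R, t \in `[0, T] ->
          memristor_current g t phi_gamma0 Pgamma =
          memristor_current g t phi_bar Pgamma) ->
       derive1 g phi_gamma0 = derive1 g phi_bar)).
Proof.
have {}hP0 : forall t : R, t \in `[0, 4 * tau] ->
    P0 t (gamma 0%N) 0 = block_drive tau t.
  rewrite -hT => t tT; rewrite hP0// /block_drive hT.
  by congr block_signal; lra.
subst T; have /andP[l0 lL] := hl; split.
  exists (forward_flux sigma g S P0 phi0), (forward_current sigma g S P0 phi0),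
    (forward_voltage sigma g S P0 phi0).
  exact: (forward_solution hsigma hg lL htau hS hP0).
move=> phi J P sol; split=> [kappa|Pgamma phi_gamma0 phi_bar currents_eq].
  exact: (solution_returns hsigma hg lL htau hS hP0 l0 sol).
have T0 : 0 \in `[0, 4 * tau] by rewrite in_itv/= lexx mulr_ge0// ltW.
have Pgamma0 : Pgamma 0 != 0.
  rewrite /Pgamma.
  have lL' : (l.-1 <= L)%N by rewrite (leq_trans (leq_pred _)).
  have [Ppath _] :=
    solution_follows_path hsigma hg lL htau hS hP0 l0 sol lL' T0.
  by rewrite Ppath ?leq_pred//; exact: path_voltage_neq0.
(* at t = 0 both integrals are over a point *)
have := currents_eq 0 T0; rewrite /memristor_current set_itv1 Rintegral_set1.
by rewrite !addr0 => /(mulIf Pgamma0).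
Qed.
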